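(* Every generalized lattice string $\eta$ is a recursive string. That is, $$\eta=\sum_{n=0}^\infty s_n\,\delta_{\{r^{-n}\}},$$ where $0<r<1$ and the sequence of multiplicities $\{s_n\}_{n=0}^\infty\subset\mathbb{C}$ satisfies a linear recurrence relation $\mathcal{R}$.
   Context: $\mathbb{N}=\{1,2,3,\ldots\}$; $\delta_{\{x\}}$ denotes the Dirac mass at $x\in(0,\infty)$. Generalized fractal string: a local complex or local positive measure on $(0,\infty)$ which is supported on a subset of $(x_0,\infty)$ for some $x_0>0$ (a local measure is a function on the Borel $\sigma$-algebra of $(0,\infty)$ which is a complex measure when restricted to any bounded subinterval, or a locally bounded positive measure in the positive case). Generalized self-similar string: a discrete generalized fractal string $\eta$ for which there are $K,N\in\mathbb{N}$, gaps $\mathbf{g}=(g_1,\ldots,g_K)\in(0,\infty)^K$, initial scaling ratios $(r_1,\ldots,r_N)\in(0,1)^N$ and initial multiplicities $(m_1,\ldots,m_N)\in\mathbb{C}^N$ such that $$\eta=\sum_{k=1}^K\sum_{J\in\mathscr{J}}m_J\,\delta_{\{g_k^{-1}r_J^{-1}\}},$$ where $\mathscr{J}$ is the set of all finite words $J=j_1\cdots j_q$ ($q\ge0$) in the symbols $1,\ldots,N$, $r_J=\prod_{i=1}^q r_{j_i}$, $m_J=\prod_{i=1}^q m_{j_i}$, and $r_J=m_J=1$ for the empty word. Generalized lattice string: a generalized self-similar string for which there is a unique $0<r<1$, called its multiplicative generator, and positive integers $k_j$ such that $r_j=r^{k_j}$ for each $j=1,\ldots,N$. Linear recurrence relation: a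 sequence $\{s_n\}_{n=0}^\infty\subset\mathbb{C}$ satisfies a linear recurrence relation $\mathcal{R}$ if there exist $d\in\mathbb{N}$ and $(a_1,\ldots,a_d)\in\mathbb{C}^d$ with $a_d\neq0$ such that $s_n=a_1s_{n-1}+\cdots+a_ds_{n-d}$ for all $n\ge d$. Recursive string: given $K\in\mathbb{N}$, $0<r<1$, gaps $(g_1,\ldots,g_K)\in(0,\infty)^K$ and a sequence $\{s_n\}_{n=0}^\infty\subset\mathbb{C}$ satisfying a linear recurrence relation, it is the discrete generalized fractal string $\sum_{k=1}^K\sum_{n=0}^\infty s_n\,\delta_{\{g_k^{-1}r^{-n}\}}$. The displayed formula in the claim is of this form with the single gap $g_1=1$ ($K=1$).
   Formalization: The displayed formula is proved for the single gap 1 (for other gaps, with Dirac masses at g_k^{-1}r^{-n}), excluding strings that reduce to the sum of the gap masses, where it fails; the generator r is made unique by requiring gcd of the k_j to be 1. *)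

(* Defs.v *)
From HB Require Import structures.
From mathcomp Require Import all_boot all_order all_algebra.
From mathcomp Require Import all_classical all_reals all_analysis.
From mathcomp Require Import complex.

Set Implicit Arguments.
Unset Strict Implicit.
Unset Printing Implicit Defensive.

Import Order.TTheory GRing.Theory Num.Theory.
Import numFieldNormedType.Exports.

Local Open Scope classical_set_scope.
Local Open Scope ring_scope.
Local Open Scope complex_scope.

(* A local complex measure need not have a value on an unbounded set, and a
   local positive measure may be infinite there.  A local measure is therefore
   a set function that is only looked at on the bounded Borel subsets of
   (0, oo); its values on all other sets are irrelevant. *)
Definition bounded_borel (R : realType) (A : set R) : Prop :=
  measurable A /\ exists b : R, A `<=` `]0, b].

Definition eq_local (R : realType) (mu nu : set R -> R[i]) : Prop :=
  forall A : set R, bounded_borel A -> mu A = nu A.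

Notation "mu =loc nu" := (eq_local mu nu) (at level 70, no associativity).

(* Every bounded subinterval of (0, oo) lies in some ]0, b], and a complex
   measure is a pair of finite signed measures (charges). *)
Definition local_complex_measure (R : realType) (eta : set R -> R[i]) : Prop :=
  forall b : R, exists mu nu : {charge set R -> \bar R},
    forall A : set R, measurable A -> A `<=` `]0, b] ->
      eta A = fine (mu A) +i* fine (nu A).

Definition local_positive_measure (R : realType) (eta : set R -> R[i]) : Prop :=
  exists mu : {measure set R -> \bar R},
    (forall b : R, (mu `]0%R, b]%classic < +oo)%E) /\
    eta =loc (fun A => (fine (mu A))%:C).

Record fractal_string (R : realType) := FractalString {
  fractal_string_val :> set R -> R[i];
  fractal_string_local :
    local_complex_measure fractal_string_val \/
    local_positive_measure fractal_string_val;
  fractal_string_support : exists2 x0 : R, 0 < x0 &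
    forall A : set R, measurable A -> A `<=` `]0, x0] ->
      fractal_string_val A = 0
}.

Definition diracC (R : realType) (x : R) (A : set R) : R[i] :=
  (fine (\d_x A))%:C.

(* \sum_i w_i delta_{x_i}.  The big operator is the sum over a finite support
   (and 0 if the support is infinite).  All families used below have finitely
   many points x_i in each ]0, b], so on a bounded Borel set this is the true
   sum. *)
Definition dirac_sum (R : realType) (I : choiceType) (x : I -> R)
    (w : I -> R[i]) (A : set R) : R[i] :=
  \sum_(i \in [set: I]) w i * diracC (x i) A.

Definition word_prod (S : pzSemiRingType) (N : nat) (c : 'I_N -> S)
    (J : seq 'I_N) : S :=
  \prod_(j <- J) c j.

Definition self_similar_sum (R : realType) (K N : nat) (g : 'I_K -> R)
    (ratio : 'I_N -> R) (mult : 'I_N -> R[i]) (A : set R) : R[i] :=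
  \sum_(k < K) dirac_sum (fun J => (g k)^-1 * (word_prod ratio J)^-1)
                         (word_prod mult) A.

Definition self_similar_form (R : realType) (eta : fractal_string R)
    (K N : nat) (g : 'I_K -> R) (ratio : 'I_N -> R)
    (mult : 'I_N -> R[i]) : Prop :=
  [/\ (0 < K)%N, (0 < N)%N, forall k, 0 < g k,
      forall j, 0 < ratio j < 1 & eta =loc self_similar_sum g ratio mult].

(* Without the gcd condition the generator would never be unique: if r works
   with exponents k_j, then Num.sqrt r works with exponents 2 k_j. *)
Definition multiplicative_generator (R : realType) (N : nat)
    (ratio : 'I_N -> R) (r : R) : Prop :=
  0 < r < 1 /\
  exists k : 'I_N -> nat,
    [/\ forall j, (0 < k j)%N, \big[gcdn/0]_(j < N) k j = 1%N &
        forall j, ratio j = r ^+ k j].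

Definition lattice_form (R : realType) (eta : fractal_string R)
    (K N : nat) (g : 'I_K -> R) (ratio : 'I_N -> R)
    (mult : 'I_N -> R[i]) (r : R) : Prop :=
  self_similar_form eta g ratio mult /\
  unique (multiplicative_generator ratio) r.

Definition lattice_string (R : realType) (eta : fractal_string R) : Prop :=
  exists (K N : nat) (g : 'I_K -> R) (ratio : 'I_N -> R)
         (mult : 'I_N -> R[i]) (r : R),
    lattice_form eta g ratio mult r.

(* Because a_d is nonzero and the relation starts at n = d, the sequence
   1, 0, 0, ... is not linearly recurrent. *)
Definition linear_recurrent (C : pzRingType) (s : nat -> C) : Prop :=
  exists (d : nat) (a : nat -> C),
    [/\ (0 < d)%N, a d <> 0 &
        forall n, (d <= n)%N -> s n = \sum_(1 <= i < d.+1) a i * s (n - i)%N].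

Definition recursive_sum (R : realType) (K : nat) (g : 'I_K -> R) (r : R)
    (s : nat -> R[i]) (A : set R) : R[i] :=
  \sum_(k < K) dirac_sum (fun n => (g k)^-1 * r ^- n) s A.

Definition recursive_form (R : realType) (eta : fractal_string R)
    (K : nat) (g : 'I_K -> R) (r : R) (s : nat -> R[i]) : Prop :=
  [/\ (0 < K)%N, 0 < r < 1, forall k, 0 < g k, linear_recurrent s &
      eta =loc recursive_sum g r s].

Definition recursive_string (R : realType) (eta : fractal_string R) : Prop :=
  exists (K : nat) (g : 'I_K -> R) (r : R) (s : nat -> R[i]),
    recursive_form eta g r s.

(* The gcd condition only normalizes r: any r and exponents k_j yield the
   multiplicative generator r ^+ gcd(k_j), and it is unique. *)
Lemma multiplicative_generator_exists (R : realType) (N : nat)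
    (ratio : 'I_N -> R) (r : R) (k : 'I_N -> nat) :
  (0 < N)%N -> 0 < r < 1 -> (forall j, 0 < k j)%N ->
  (forall j, ratio j = r ^+ k j) ->
  multiplicative_generator ratio (r ^+ \big[gcdn/0]_(j < N) k j).
Proof.
move=> N0 /andP[r0 r1] k0 rk.
set G := \big[gcdn/0]_(j < N) k j.
have Gk j : (G %| k j)%N by rewrite /G (bigD1 j) //= dvdn_gcdl.
have G0 : (0 < G)%N by apply: dvdn_gt0 (k0 (Ordinal N0)) (Gk _).
split; first by rewrite exprn_gt0 //= exprn_ilt1 ?ltW // -lt0n.
exists (fun j => k j %/ G)%N; split.
- by move=> j; rewrite divn_gt0 // dvdn_leq.
- have : (G * \big[gcdn/0]_(j < N) (k j %/ G) = G)%N.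
    rewrite (big_morph (fun n => G * n)%N (muln_gcdr G) (muln0 G)).
    by apply: eq_bigr => j _; rewrite mulnC divnK.
  by move=> /eqP; rewrite -[eqbRHS]muln1 eqn_pmul2l // => /eqP.
- by move=> j; rewrite -exprM mulnC divnK.
Qed.

Lemma multiplicative_generator_unique (R : realType) (N : nat)
    (ratio : 'I_N -> R) (r : R) :
  (0 < N)%N -> multiplicative_generator ratio r ->
  unique (multiplicative_generator ratio) r.
Proof.
move=> N0 gr; split=> // r' [/andP[r'0 r'1] [k' [k'0 G' rk']]].
case: gr => /andP[r0 r1] [k [k0 G rk]].
have kk i j : (k j * k' i = k' j * k i)%N.
  apply: (ieexprIn r0); first by rewrite lt_eqF.
  by rewrite exprM -rk [in RHS]mulnC exprM -rk !rk' -!exprM mulnC.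
have ekk j : k j = k' j.
  rewrite -[LHS]muln1 -[RHS]muln1 -{1}G' -G.
  rewrite (big_morph (muln (k j)) (muln_gcdr _) (muln0 _)).
  rewrite (big_morph (muln (k' j)) (muln_gcdr _) (muln0 _)).
  exact: eq_bigr.
pose j := Ordinal N0.
apply: (pexpIrn (k0 j)); rewrite ?nnegrE ?ltW //.
by rewrite -rk rk' ekk.
Qed.

(* Main.v *)
(* Over a lattice, r_J = r^(wt J) depends only on the weight of the word J, so
   the masses at g_k^-1 r^-n add up to s_n, the sum of m_J over the words of
   weight n.  Splitting off the first letter of J gives
   s_n = sum_j m_j s_(n - k_j) for n >= 1, whose coefficients are
   a_i = sum_(k_j = i) m_j, and the order of the recurrence is the last i with
   a_i <> 0.  If all a_i vanish, then s = 1, 0, 0, ..., which is not recurrent;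
   the string sum_k delta_{g_k^-1} is then recovered from the sequence (-1)^n by
   doubling every gap g to g, g r. *)

Require Import Defs.
From HB Require Import structures.
From mathcomp Require Import all_boot all_order all_algebra.
From mathcomp Require Import all_classical all_reals all_analysis.
From mathcomp Require Import complex.

Import Order.TTheory GRing.Theory Num.Theory.
Import numFieldNormedType.Exports.

Local Open Scope classical_set_scope.
Local Open Scope ring_scope.
Local Open Scope complex_scope.

Set Implicit Arguments.
Unset Strict Implicit.

(** * Words graded by length and by weight *)

Section Words.
Variable N : nat.
Implicit Types (J : seq 'I_N) (k : 'I_N -> nat).

(** A finite exhaustion of the infinite set of words, so that sums over words become ordinary finite
    sums. *)
Fixpoint words_upto (q : nat) : seq (seq 'I_N) :=
  if q is q'.+1 then
    [::] :: [seq j :: J | j <- index_enum 'I_N, J <- words_upto q']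
  else [:: [::]].

Definition weight k J : nat := \sum_(j <- J) k j.

Lemma mem_words_upto q J : (J \in words_upto q) = (size J <= q)%N.
Proof.
elim: q J => [|q IH] [|j J] //=; rewrite inE /=.
apply/allpairsP/idP => [[[i I] /= [_ + [_ ->]]]|Jq]; first by rewrite IH.
by exists (j, J); rewrite /= mem_index_enum IH.
Qed.

Lemma words_upto_uniq q : uniq (words_upto q).
Proof.
elim: q => [|q IH] //=; apply/andP; split.
  by apply/negP => /allpairsP[[i I] /= []].
apply: allpairs_uniq => //; first exact: index_enum_uniq.
by move=> [i I] [j J] _ _ /= [-> ->].
Qed.

Lemma big_words_uptoS (V : nmodType) (q : nat) (F : seq 'I_N -> V) :
  \sum_(J <- words_upto q.+1) F J =
  F [::] + \sum_(j < N) \sum_(J <- words_upto q) F (j :: J).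
Proof. by rewrite /= big_cons big_allpairs_dep. Qed.

Lemma size_le_weight k J : (forall j, 0 < k j)%N -> (size J <= weight k J)%N.
Proof.
by move=> k0; rewrite -sum1_size; apply: leq_sum => j _; apply: k0.
Qed.

Lemma word_prod_expr (S : pzSemiRingType) (c : 'I_N -> S) (r : S) k J :
  (forall j, c j = r ^+ k j) -> word_prod c J = r ^+ weight k J.
Proof.
move=> ck; rewrite /word_prod /weight.
rewrite (big_morph (GRing.exp r) (exprD r) (expr0 r)).
by apply: eq_bigr => j _; rewrite ck.
Qed.

Section WeightSum.
Variables (S : comPzRingType) (k : 'I_N -> nat) (m : 'I_N -> S).
Hypothesis k0 : forall j, (0 < k j)%N.

Definition weight_sum (n : nat) : S :=
  \sum_(J <- words_upto n | weight k J == n) word_prod m J.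

(** Each letter weighs at least 1, so a word of weight [n] has length at most [n], and any cutoff
    [q] from [n] on catches all of them. *)
Lemma weight_sumE q n : (n <= q)%N ->
  weight_sum n = \sum_(J <- words_upto q | weight k J == n) word_prod m J.
Proof.
move=> nq; rewrite /weight_sum -big_filter -[RHS]big_filter; apply: perm_big.
apply: uniq_perm; rewrite ?filter_uniq ?words_upto_uniq // => J.
rewrite !mem_filter !mem_words_upto; case: eqP => //= Jn.
have Jle : (size J <= n)%N by rewrite -Jn size_le_weight.
by rewrite Jle (leq_trans Jle nq).
Qed.

Lemma weight_sum0 : weight_sum 0 = 1.
Proof.
by rewrite /weight_sum /= big_mkcond big_seq1 /weight /word_prod !big_nil.
Qed.

Lemma weight_sum_rec n : (0 < n)%N ->
  weight_sum n = \sum_(j < N | (k j <= n)%N) m j * weight_sum (n - k j).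
Proof.
move=> n0; rewrite (@weight_sumE n.+1) // big_mkcond big_words_uptoS.
rewrite /weight big_nil eq_sym (gtn_eqF n0) add0r [RHS]big_mkcond /=.
apply: eq_bigr => j _; case: leqP => [kn|nk].
  rewrite (@weight_sumE n) ?leq_subr // big_distrr /= [RHS]big_mkcond.
  apply: eq_bigr => J _; rewrite big_cons /word_prod big_cons /weight.
  by rewrite -{1}(subnKC kn) eqn_add2l.
apply: big1 => J _; rewrite big_cons gtn_eqF //.
exact: leq_trans nk (leq_addr _ _).
Qed.

(** Fubini: the words are grouped by weight. Later [h] is the Dirac mass at a point that depends on
    the weight alone. *)
Lemma sum_words_weight q (h : nat -> S) :
  \sum_(J <- words_upto q | (weight k J <= q)%N)
    word_prod m J * h (weight k J) =
  \sum_(n < q.+1) weight_sum n * h n.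
Proof.
under [RHS]eq_bigr => n _ do
  rewrite (@weight_sumE q (n : nat)) -1?ltnS // big_distrl /= big_mkcond /=.
rewrite exchange_big /= big_mkcond; apply: eq_bigr => J _.
rewrite -big_mkcond /=; case: leqP => [Jq|qJ].
  rewrite (big_pred1 (Ordinal (Jq : (weight k J < q.+1)%N))) //.
by rewrite big1 // => n /eqP Jn; move: (ltn_ord n); rewrite -Jn ltnS leqNgt qJ.
Qed.

End WeightSum.
End Words.

(** * Linear recurrences *)

Lemma lag_sum_recurrent (S : comPzRingType) (N : nat) (k : 'I_N -> nat)
    (m : 'I_N -> S) (s : nat -> S) :
  (forall j, 0 < k j)%N ->
  (forall n, (0 < n)%N ->
     s n = \sum_(j < N | (k j <= n)%N) m j * s (n - k j)%N) ->
  linear_recurrent s \/ forall n, (0 < n)%N -> s n = 0.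
Proof.
move=> k0 sE.
pose a i := \sum_(j < N | k j == i) m j.
have {}sE n : (0 < n)%N -> s n = \sum_(1 <= i < n.+1) a i * s (n - i)%N.
  move=> n0; rewrite sE // [RHS](eq_bigr _ (fun i _ => mulr_suml _ _ _ _)).
  rewrite (exchange_big_dep xpredT) //= big_mkcond; apply: eq_bigr => j _.
  under [RHS]eq_bigl do rewrite eq_sym.
  by rewrite big_nat1_eq k0 ltnS.
have [[i ai]|a0] := pselect (exists i, a i != 0).
  (* Beyond the largest lag [a i'] is an empty sum; this bound makes a last nonzero coefficient
     exist. *)
  have aub i' : a i' != 0 -> (i' <= \max_(j < N) k j)%N.
    apply: contra_neqT; rewrite -ltnNge => /= lt; apply: big1 => j /eqP kj.
    by move: lt; rewrite -kj ltnNge leq_bigmax.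
  have [d ad dmax] := ex_maxnP (ex_intro _ i ai) aub.
  have d0 : (0 < d)%N.
    rewrite lt0n; apply: contra_neq ad => ->; apply: big1 => j /eqP kj.
    by move: (k0 j); rewrite kj.
  left; exists d, a; split=> //; first exact/eqP.
  (* The sum up to [n] is cut after [d]; the tail vanishes since [d] is the last index with a
     nonzero coefficient. *)
  move=> n dn; rewrite sE ?(leq_trans d0) // (@big_cat_nat _ _ _ d.+1) //=.
  rewrite [X in _ + X]big_nat [X in _ + X]big1 ?addr0 // => j /andP[dj _].
  have [->|aj] := eqVneq (a j) 0; first by rewrite mul0r.
  by move: (dmax _ aj); rewrite leqNgt dj.
right=> n n0; rewrite sE // big1 // => i _.
have [->|ai] := eqVneq (a i) 0; first by rewrite mul0r.
by case: a0; exists i.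
Qed.

Lemma alternating_recurrent (S : nzRingType) :
  linear_recurrent (fun n : nat => (-1) ^+ n : S).
Proof.
exists 1%N, (fun=> -1); split=> //.
  by apply/eqP; rewrite oppr_eq0 oner_neq0.
by case=> // n _; rewrite big_nat1 subn1 exprS.
Qed.

(** * Dirac sums on bounded Borel sets *)

Section DiracSums.
Variable R : realType.
Implicit Types (A : set R) (x r : R).

Lemma diracC_out x A : ~ A x -> diracC x A = 0.
Proof. by move=> Ax; rewrite /diracC diracE memNset. Qed.

Lemma diracC_geometric_out x r A : 0 < x -> 0 < r < 1 -> bounded_borel A ->
  exists M : nat, forall n, (M <= n)%N -> diracC (x * r ^- n) A = 0.
Proof.
move=> x0 /andP[r0 r1] [_ [b Ab]].
(* The bound [b] may be negative or zero, so the positive number [|b| + 1] replaces it. *)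
have e0 : 0 < x / (`|b| + 1) by rewrite divr_gt0 // ltr_wpDl.
have r_to0 : (r ^+ n @[n --> \oo] --> (0 : R)).
  by apply: cvg_expr; rewrite gtr0_norm.
have [M _ HM] : \forall n \near \oo, `|r ^+ n| < x / (`|b| + 1).
  exact: cvgr0_norm_lt.
exists M => n Mn; apply: diracC_out => /Ab /=; rewrite in_itv /= => /andP[_].
apply/negP; rewrite -ltNge.
have := HM n Mn; rewrite /= gtr0_norm ?exprn_gt0 //.
rewrite ltr_pdivlMr ?ltr_wpDl // mulrC -ltr_pdivlMr ?exprn_gt0 //.
by apply: lt_trans; rewrite (le_lt_trans (ler_norm b)) // ltrDl.
Qed.

Lemma dirac_sum_nat (x : nat -> R) (s : nat -> R[i]) A (M : nat) :
  (forall n, (M <= n)%N -> diracC (x n) A = 0) ->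
  dirac_sum x s A = \sum_(n < M) s n * diracC (x n) A.
Proof.
move=> xM; rewrite /dirac_sum (fsbig_ord _ _ (fun n => s n * diracC (x n) A)).
apply/esym/fsbig_widen => //= n [_ /negP]; rewrite -leqNgt => Mn.
by rewrite /= xM ?mulr0.
Qed.

Lemma dirac_sum_words (N : nat) (k : 'I_N -> nat) (m : 'I_N -> R[i])
    (x r : R) A : (forall j, 0 < k j)%N -> 0 < x -> 0 < r < 1 ->
  bounded_borel A ->
  dirac_sum (fun J => x * r ^- weight k J) (word_prod m) A =
  dirac_sum (fun n => x * r ^- n) (weight_sum k m) A.
Proof.
move=> k0 x0 r01 bA; have [M xM] := diracC_geometric_out x0 r01 bA.
rewrite (@dirac_sum_nat _ _ _ M.+1); last by move=> n /ltnW /xM.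
rewrite -(sum_words_weight m k0 M (fun n => diracC (x * r ^- n) A)).
rewrite /dirac_sum (fsbigE (words_upto N M)) ?words_upto_uniq //=.
  rewrite [RHS]big_mkcond [LHS]big_mkcond; apply: eq_bigr => J _.
  rewrite in_setT; case: leqP => // /ltnW MJ.
  by rewrite xM ?mulr0.
(* A word longer than [M] also weighs more than [M], so its point lies outside [A]. *)
move=> J _; rewrite mem_words_upto -ltnNge => MJ.
by rewrite xM ?mulr0 // ltnW // (leq_trans MJ) // size_le_weight.
Qed.

(** The second family is the first shifted by one index, with opposite signs at common points, so
    everything telescopes except the mass at [x]. *)
Lemma dirac_sum_alternating x r A : 0 < x -> 0 < r < 1 -> bounded_borel A ->
  dirac_sum (fun n => x * r ^- n) (fun n => (-1) ^+ n) A +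
  dirac_sum (fun n => x / r * r ^- n) (fun n => (-1) ^+ n) A = diracC x A.
Proof.
move=> x0 r01 bA; have [M xM] := diracC_geometric_out x0 r01 bA.
have xS n : x / r * r ^- n = x * r ^- n.+1 by rewrite -mulrA -invfM -exprS.
rewrite !(@dirac_sum_nat _ _ _ M) //; last first.
  by move=> n Mn; rewrite xS xM // ltnW.
rewrite -big_split /=.
(* Adding a boundary term, zero for this [M], gives an identity valid for every [M], which induction
   can prove. *)
have -> : diracC x A =
    diracC (x * r ^- 0) A - (-1) ^+ M * diracC (x * r ^- M) A.
  by rewrite (xM M) // mulr0 subr0 expr0 invr1 mulr1.
elim: M {xM} => [|M IH]; first by rewrite big_ord0 expr0 mul1r subrr.
rewrite big_ord_recr /= {}IH xS [(-1) ^+ _.+1]exprS mulN1r mulNr opprK.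
by rewrite addrA subrK.
Qed.

End DiracSums.

(** * Lattice strings as recursive strings *)

Lemma lattice_sequence (R : realType) (eta : fractal_string R) (K N : nat)
    (g : 'I_K -> R) (ratio : 'I_N -> R) (mult : 'I_N -> R[i]) (r : R) :
  lattice_form eta g ratio mult r ->
  (exists s : nat -> R[i], recursive_form eta g r s) \/
  eta =loc (fun A => \sum_(k < K) diracC (g k)^-1 A).
Proof.
move=> [[K0 _ g0 _ etaE] [[r01 [k [k0 _ rk]]] _]].
have {}etaE : eta =loc recursive_sum g r (weight_sum k mult).
  move=> A bA; rewrite etaE //; apply: eq_bigr => l _.
  rewrite -dirac_sum_words ?invr_gt0 //; apply: eq_fsbigr => J _.
  by rewrite (word_prod_expr J rk).
have [rec|s0] := lag_sum_recurrent k0 (weight_sum_rec mult k0).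
  by left; exists (weight_sum k mult).
right=> A bA; rewrite etaE //; apply: eq_bigr => l _.
have gV0 : 0 < (g l)^-1 by rewrite invr_gt0.
have [M gM] := diracC_geometric_out gV0 r01 bA.
(* The cutoff [M.+1] keeps the term of index 0, the only nonzero mass, even when [M] is 0. *)
rewrite (@dirac_sum_nat _ _ _ _ M.+1); last by move=> n /ltnW /gM.
rewrite big_ord_recl big1 ?addr0 => [|n _]; last by rewrite s0 ?mul0r.
by rewrite weight_sum0 mul1r expr0 invr1 mulr1.
Qed.

Definition gaps_doubled (R : realType) (K : nat) (g : 'I_K -> R) (r : R)
    (i : 'I_(K + K)) : R :=
  match fintype.split i with inl k => g k | inr k => g k * r end.

Lemma recursive_sum_diracs (R : realType) (K : nat) (g : 'I_K -> R) (r : R) :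
  0 < r < 1 -> (forall k, 0 < g k) ->
  recursive_sum (gaps_doubled g r) r (fun n => (-1) ^+ n) =loc
  (fun A => \sum_(k < K) diracC (g k)^-1 A).
Proof.
move=> r01 g0 A bA; rewrite /recursive_sum big_split_ord /= -big_split /=.
apply: eq_bigr => k _.
rewrite /gaps_doubled (unsplitK (inl k)) (unsplitK (inr k)) invfM.
by rewrite dirac_sum_alternating ?invr_gt0.
Qed.

(** With the single gap 1 the points [r ^- n] are distinct, so the string determines [s]. For
    [diracC 1] this forces 1, 0, 0, ..., which is not recurrent; hence the exclusion in the last
    claim. *)
Theorem theorem4p11 (R : realType) (eta : fractal_string R) :
  lattice_string eta ->
  [/\ recursive_string eta,
      (forall (K N : nat) (g : 'I_K -> R) (ratio : 'I_N -> R)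
              (mult : 'I_N -> R[i]) (r : R),
         lattice_form eta g ratio mult r ->
         ~ (eta =loc (fun A => \sum_(k < K) diracC (g k)^-1 A)) ->
         exists s : nat -> R[i], recursive_form eta g r s) &
      (forall (N : nat) (ratio : 'I_N -> R) (mult : 'I_N -> R[i]) (r : R),
         lattice_form eta (fun _ : 'I_1 => 1) ratio mult r ->
         ~ (eta =loc diracC 1) ->
         exists s : nat -> R[i],
           [/\ 0 < r < 1, linear_recurrent s &
               eta =loc dirac_sum (fun n => r ^- n) s])].
Proof.
move=> [K [N [g [ratio [mult [r lat]]]]]]; split.
- have [[s rec]|etaE] := lattice_sequence lat; first by exists K, g, r, s.
  have [[K0 _ g0 _ _] [[r01 _] _]] := lat.
  exists (K + K)%N, (gaps_doubled g r), r, (fun n => (-1) ^+ n); split=> //.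
  + by rewrite addn_gt0 K0.
  + move=> i; rewrite /gaps_doubled; case: fintype.split => k //.
    by rewrite mulr_gt0 //; case/andP: r01.
  + exact: alternating_recurrent.
  + by move=> A bA; rewrite etaE // recursive_sum_diracs.
- move=> {}K {}N {}g {}ratio {}mult {}r {}lat neq.
  by have [|/neq] := lattice_sequence lat.
- move=> {}N {}ratio {}mult {}r {}lat neq.
  have [[s [_ r01 _ rec etaE]]|etaE] := lattice_sequence lat.
    exists s; split=> // A bA; rewrite etaE // /recursive_sum big_ord1.
    by apply: eq_fsbigr => n _; rewrite invr1 mul1r.
  by case: neq => A bA; rewrite etaE // big_ord1 invr1.
Qed.
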